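(* Consider the delayed online convex optimization setting described in the context, with a non-empty, closed, convex domain $\mathcal{X}\subseteq\mathbb{R}^n$ containing $\mathbf{0}$ and with $\max_{x,y\in\mathcal{X}}\|x-y\|_2\le D$ for some $D>0$. Let $\alpha>0$, $G>0$, and assume every loss $f_t$ is $\alpha$-exp-concave (i.e. $x\mapsto\exp(-\alpha f_t(x))$ is concave on $\mathcal{X}$) and satisfies $\max_{x\in\mathcal{X}}\|\nabla f_t(x)\|_2\le G$. Let $\beta=\frac12\min\{\frac{1}{4GD},\alpha\}$ and let $0<\eta_0\le\eta_1\le\dots\le\eta_T$ be learning rates. Consider the learner (Delayed ONS) that plays an arbitrary $x_1\in\mathcal{X}$ and, for each $t\ge1$, after observing $g_\tau$ for all $\tau\in o_{t+1}\setminus o_t$, plays $$x_{t+1}\in\arg\min_{x\in\mathcal{X}}\ \sum_{\tau\in o_{t+1}}\left(\langle g_\tau,x\rangle+\frac{\beta}{2}\langle g_\tau,x-x_\tau\rangle^2\right)+\frac{\eta_t}{2}\|x\|_2^2 .$$ Then $$\mathrm{Reg}_T=\mathcal{O}\left(\frac{n}{\beta}\ln\left(1+\frac{\beta G^2T}{\eta_0 n}\right)+\eta_T D^2+\min\{B_1,B_2\}\right),$$ where $B_1=\left(\frac{G^2}{\eta_0}+\frac1\beta\right)n\,d_{\max}\ln\left(1+\frac{\beta G^2T}{\eta_0 n}\right)$ and $B_2=G^2\sum_{t=1}^T\frac{|m_t|}{\eta_{t-1}}$; here $\mathcal{O}$ hides only an absolute numerical constant.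
   Context: Delayed OCO setting: $T\ge1$ and $n\ge1$ are integers, $[T]=\{1,\dots,T\}$. For each round $t\in[T]$ the learner chooses $x_t\in\mathcal{X}$ and incurs loss $f_t(x_t)$, where $f_t:\mathcal{X}\to\mathbb{R}$ is convex and differentiable (possibly adversarial). The gradient $g_t=\nabla f_t(x_t)$ is revealed to the learner only at the end of round $t+d_t$, where $d_t\in\{0,1,2,\dots\}$ is an arbitrary delay unknown to the learner, with $t+d_t\le T$ for all $t\in[T]$. For $t\ge1$ define $o_t=\{\tau\in\mathbb{N}:\tau+d_\tau<t\}\subseteq[t-1]$ and $m_t=[t-1]\setminus o_t$. Let $d_{\max}=\max_{t\in[T]}d_t$. The regret is $\mathrm{Reg}_T=\sup_{u\in\mathcal{X}}\sum_{t=1}^T(f_t(x_t)-f_t(u))$. The learning rate $\eta_t$ used to compute $x_{t+1}$ may depend on information available at the end of round $t$. *)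

(* Defs.v *)
From HB Require Import structures.
From mathcomp Require Import all_boot all_order all_algebra.
From mathcomp Require Import all_classical all_reals all_analysis.
Set Implicit Arguments.
Unset Strict Implicit.
Unset Printing Implicit Defensive.
Import Order.TTheory GRing.Theory Num.Theory.
Import numFieldNormedType.Exports.
Local Open Scope classical_set_scope.
Local Open Scope ring_scope.

Section DelayedOCO.
Variable R : realType.
Variable n : nat.

Definition dotv (u v : 'rV[R]_n) : R := \sum_(i < n) u ord0 i * v ord0 i.
Definition norm2 (v : 'rV[R]_n) : R := Num.sqrt (\sum_(i < n) (v ord0 i) ^+ 2).

Definition grad (f : 'rV[R]_n -> R) (x : 'rV[R]_n) : 'rV[R]_n :=
  \row_(i < n) ('d f x (delta_mx ord0 i : 'rV[R]_n)).

Definition convex_on (X : set 'rV[R]_n) (f : 'rV[R]_n -> R) : Prop :=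
  forall x y, X x -> X y -> forall l : R, 0 <= l <= 1 ->
    f (l *: x + (1 - l) *: y) <= l * f x + (1 - l) * f y.

Definition exp_concave_on (alpha : R) (X : set 'rV[R]_n) (f : 'rV[R]_n -> R) : Prop :=
  forall x y, X x -> X y -> forall l : R, 0 <= l <= 1 ->
    l * expR (- alpha * f x) + (1 - l) * expR (- alpha * f y)
      <= expR (- alpha * f (l *: x + (1 - l) *: y)).

(* Delayed ONS objective used to compute x_{t+1}:
   sum_{tau in o_{t+1}} (<g_tau,y> + beta/2 <g_tau, y - x_tau>^2) + eta_t/2 ||y||^2,
   where o_{t+1} = {tau in [t] : tau + d_tau < t+1} and g_tau = grad f_tau (x_tau). *)
Definition ons_objective (f : nat -> 'rV[R]_n -> R) (d : nat -> nat)
    (x : nat -> 'rV[R]_n) (beta : R) (eta : nat -> R) (t : nat) (y : 'rV[R]_n) : R :=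
  \sum_(1 <= tau < t.+1 | (tau + d tau < t.+1)%N)
     (dotv (grad (f tau) (x tau)) y
      + beta / 2 * (dotv (grad (f tau) (x tau)) (y - x tau)) ^+ 2)
  + eta t / 2 * (norm2 y) ^+ 2.

End DelayedOCO.

(* |m_t| = |[t-1] \ o_t| : number of rounds tau in [t-1] with tau + d_tau >= t *)
Definition card_m (d : nat -> nat) (t : nat) : nat :=
  \sum_(1 <= tau < t | ~~ (tau + d tau < t)%N) 1.

Definition dmax (d : nat -> nat) (T : nat) : nat := \max_(1 <= t < T.+1) d t.

(* Main.v *)
(** Exp-concavity replaces f_t by the quadratic surrogate
    l_t(y) = <g_t, y> + beta/2 <g_t, y - x_t>^2, whose regret dominates that of f_t.
    Let z_t minimise over X the undelayed objective
    sum_(s <= t) l_s + eta_(t-1)/2 |.|^2. Be-the-leader bounds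
    sum_t (l_t(z_t) - l_t(u)) by eta_T D^2 / 2, and there remains
    sum_t <g_t, x_t - z_t>. For A_t = eta_(t-1) I + beta sum_(s <= t) g_s^T g_s, the
    first-order conditions of x_t and z_t bound |x_t - z_t|_(A_t)^2 by
    2 sum |<g_s, x_t - z_t>| over s in m_t or s = t, and Cauchy-Schwarz in the norm of
    A_t then gives
    <g_t, x_t - z_t> <= sum (|g_t|^2 + |g_s|^2), norms being taken for A_t^-1. The terms
    s = t sum to n/beta L by the log-determinant potential and the inequality
    det A <= (tr A / n)^n. Those in m_t are bounded by G^2 / eta_(t-1) (giving B2), or
    by the same potential with multiplicity at most d_max (giving B1). *)

Require Import Defs.
From HB Require Import structures.
From mathcomp Require Import all_boot all_order all_algebra.
From mathcomp Require Import all_classical all_reals all_analysis.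
From mathcomp Require Import ring lra zify.
Import Order.TTheory GRing.Theory Num.Theory.
Import numFieldNormedType.Exports.
Local Open Scope classical_set_scope.
Local Open Scope ring_scope.
Set Implicit Arguments.
Unset Strict Implicit.
Unset Printing Implicit Defensive.

(** * Positive definite matrices: determinants and the dual norm *)

Section PositiveDefinite.
Variable F : realFieldType.

Definition qform n (A : 'M[F]_n) (v : 'rV[F]_n) : F := (v *m A *m v^T) 0 0.

Definition posdefmx n (A : 'M[F]_n) : Prop :=
  A^T = A /\ forall v : 'rV[F]_n, v != 0 -> 0 < qform A v.

Lemma posdef_qform_ge0 n (A : 'M[F]_n) (v : 'rV[F]_n) :
  posdefmx A -> 0 <= qform A v.
Proof.
case=> _ pA; have [->|/pA/ltW//] := eqVneq v 0.
by rewrite /qform !mul0mx mxE.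
Qed.

(** Right multiplication by a unipotent lower triangular block matrix clears the block [C] without
    changing the determinant. *)
Lemma det_schur m n (A : 'M[F]_m) (B : 'M[F]_(m, n)) (C : 'M[F]_(n, m))
    (E : 'M[F]_n) : E \in unitmx ->
  \det (block_mx A B C E) = \det (A - B *m invmx E *m C) * \det E.
Proof.
move=> uE.
have := congr1 determinant (mulmx_block A B C E 1%:M 0 (- (invmx E *m C)) 1%:M).
rewrite det_mulmx det_lblock !det1 !mulr1 => ->.
rewrite !mulmx1 !mulmx0 !mulmxN !mulmxA mulmxV // mul1mx subrr !add0r.
by rewrite det_ublock.
Qed.

(* Hadamard's inequality, by induction on [n] through the Schur complement of the
   lower right block. *)
Lemma posdef_det n (A : 'M[F]_n) :
  posdefmx A -> 0 < \det A <= \prod_i A i i.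
Proof.
elim: n A => [|n IHn]; first by move=> A _; rewrite det_mx00 big_ord0 ltr01 lexx.
change (forall A : 'M[F]_(1 + n), posdefmx A -> 0 < \det A <= \prod_i A i i).
move=> A pA; pose a := ulsubmx A; pose b := ursubmx A; pose C := drsubmx A.
have symA : A = block_mx a b b^T C.
  by rewrite /b trmx_ursub (proj1 pA) submxK.
have symC : C^T = C by rewrite /C trmx_drsub (proj1 pA).
have pC : posdefmx C.
  split=> // v v0; have rv0 : row_mx (0 : 'rV[F]_1) v != 0.
    by apply: contraNneq v0 => /(congr1 (@rsubmx _ _ _ _)); rewrite row_mxKr linear0 => ->.
  have := proj2 pA _ rv0; rewrite /qform symA mul_row_block tr_row_mx mul_row_col.
  by rewrite !mul0mx !add0r trmx0 mulmx0 add0r.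
have /andP[detC_gt0 detC_le] := IHn C pC.
have uC : C \in unitmx by rewrite unitmxE unitfE gt_eqF.
(* The Schur complement is a 1 x 1 matrix whose entry is a value of the quadratic form of [A], hence
   positive; it falls short of [a 0 0] by the value of the form of [C] at [b *m invmx C]. *)
have schurE : a - b *m invmx C *m b^T = (qform A (row_mx 1%:M (- (b *m invmx C))))%:M.
  rewrite [LHS]mx11_scalar /qform symA mul_row_block tr_row_mx mul_row_col.
  rewrite mul1mx !mulNmx mulmxKV // mul1mx subrr mul0mx addr0.
  by rewrite trmx1 mulmx1.
have schur_gt0 : 0 < qform A (row_mx 1%:M (- (b *m invmx C))).
  apply: (proj2 pA); apply/eqP => /(congr1 (@lsubmx _ _ _ _)).
  by rewrite row_mxKl linear0 => /matrixP/(_ 0 0)/eqP; rewrite !mxE oner_eq0.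
have schur_le : qform A (row_mx 1%:M (- (b *m invmx C))) <= a 0 0.
  have := congr1 (fun M : 'M[F]_1 => M 0 0) schurE; rewrite !mxE mulr1n => <-.
  rewrite gerBl; have := posdef_qform_ge0 (b *m invmx C) pC.
  by rewrite /qform mulmxKV // trmx_mul trmx_inv symC mulmxA [in X in X -> _]mxE.
rewrite {1 2}symA det_schur // schurE det_scalar1 mulr_gt0 //=.
rewrite big_split_ord big_ord1 (ler_pM (ltW schur_gt0) (ltW detC_gt0)) //.
  by apply: le_trans schur_le _; rewrite !mxE.
by apply: le_trans detC_le _; under eq_bigr do rewrite !mxE.
Qed.

Lemma posdef_unitmx n (A : 'M[F]_n) : posdefmx A -> A \in unitmx.
Proof. by move=> /posdef_det/andP[A0 _]; rewrite unitmxE unitfE gt_eqF. Qed.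

(** The determinant of [A] bordered by [u], [c *: u^T] and the entry 1 is computed in two ways: by
    eliminating the entry 1, and by eliminating [A]. *)
Lemma det_sub_rank1 n (A : 'M[F]_n) (c : F) (u : 'rV[F]_n) : A \in unitmx ->
  \det (A - c *: (u^T *m u)) = (1 - c * qform (invmx A) u) * \det A.
Proof.
move=> uA; transitivity (\det (block_mx (1%:M : 'M[F]_1) u (c *: u^T) A)).
  have := congr1 determinant
    (mulmx_block (1%:M : 'M[F]_1) u (c *: u^T) A 1%:M (- u) 0 1%:M).
  rewrite det_mulmx det_ublock !det1 !mulr1 => ->.
  rewrite !mulmx1 !mulmx0 !mul1mx !addr0 addNr det_lblock det1 mul1r.
  by rewrite mulmxN scalemxAl addrC.
rewrite det_schur // -scalemxAr; congr (_ * _).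
rewrite [X in \det X]mx11_scalar det_scalar1.
by rewrite mxE [X in X + _]mxE mulr1n [X in _ + X]mxE [X in _ - X]mxE.
Qed.

(** Hadamard's inequality followed by AM-GM on the diagonal entries. *)
Lemma posdef_trace_det n (A : 'M[F]_n) : posdefmx A ->
  \det A <= (\tr A / n%:R) ^+ n.
Proof.
move=> pA; have /andP[_ /le_trans] := posdef_det pA; apply.
have diag_ge0 i : 0 <= A i i.
  have := posdef_qform_ge0 (delta_mx 0 i) pA.
  by rewrite /qform -rowE trmx_delta -colE !mxE.
have := @leif_AGM F 'I_n 'I_n (fun i => A i i) (fun i _ => diag_ge0 i).
by rewrite card_ord => -[].
Qed.

Lemma posdef_cauchy_schwarz n (A : 'M[F]_n) (g w : 'rV[F]_n) : posdefmx A ->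
  (g *m w^T) 0 0 ^+ 2 <= qform (invmx A) g * qform A w.
Proof.
move=> pA; have uA := posdef_unitmx pA; have symA := proj1 pA.
have [->|w0] := eqVneq w 0.
  by rewrite /qform trmx0 !mulmx0 mxE expr0n /= mulr0.
have := proj2 pA _ w0; set b := qform A w; set c := _ 0 0 => b_gt0.
set a := qform _ g; pose h := g *m invmx A.
(* Up to the factor [b], this vector is the [A]-orthogonal component of [h] relative to [w]; its
   form equals [b * (a * b - c ^+ 2)]. *)
have := posdef_qform_ge0 (b *: h - c *: w) pA.
have qh : (h *m A *m h^T) 0 0 = a.
  by rewrite /h mulmxKV // trmx_mul trmx_inv symA mulmxA.
have qhw : (h *m A *m w^T) 0 0 = c by rewrite /h mulmxKV.
have qwh : (w *m A *m h^T) 0 0 = c.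
  rewrite /h trmx_mul trmx_inv symA mulmxA mulmxK // /c -[in RHS](trmxK g).
  by rewrite -trmx_mul [RHS]mxE.
have -> : qform A (b *: h - c *: w) = b * (a * b - c ^+ 2).
  rewrite /qform [_^T]linearB /= ![_^T]linearZ /= !(mulmxBl, mulmxBr) -!scalemxAl.
  rewrite -!scalemxAr.
  move: qh qhw qwh; rewrite /b /qform; move: (h *m _ *m _) (h *m _ *m _).
  move: (w *m _ *m _) (w *m _ *m _) => M1 M2 M3 M4 <- <- E.
  by rewrite !mxE E; ring.
by rewrite pmulr_rge0 // subr_ge0.
Qed.

Lemma qform_invE n (A : 'M[F]_n) (g : 'rV[F]_n) : posdefmx A ->
  qform (invmx A) g = qform A (g *m invmx A).
Proof.
move=> pA; have uA := posdef_unitmx pA.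
by rewrite /qform mulmxKV // trmx_mul trmx_inv (proj1 pA) mulmxA.
Qed.

Lemma qform_inv_ge0 n (A : 'M[F]_n) (g : 'rV[F]_n) :
  posdefmx A -> 0 <= qform (invmx A) g.
Proof. by move=> pA; rewrite qform_invE // posdef_qform_ge0. Qed.

(** Testing at [w = g *m invmx A] and dividing. With Cauchy-Schwarz this characterises the dual
    norm, so inverses are compared through the forms of the matrices themselves. *)
Lemma qform_inv_le n (A : 'M[F]_n) (g : 'rV[F]_n) (q : F) : posdefmx A -> 0 <= q ->
  (forall w, (g *m w^T) 0 0 ^+ 2 <= q * qform A w) -> qform (invmx A) g <= q.
Proof.
move=> pA q_ge0 /(_ (g *m invmx A)).
rewrite -(qform_invE _ pA) trmx_mul trmx_inv (proj1 pA) mulmxA.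
have := qform_inv_ge0 g pA; rewrite le_eqVlt => /predU1P[<- //|q0].
by rewrite -/(qform _ _) expr2 ler_pM2r.
Qed.

End PositiveDefinite.

(** * The Euclidean inner product and norm *)

Section InnerProduct.
Variables (R : realType) (n : nat).
Implicit Types u v w : 'rV[R]_n.

Lemma dotvE u v : dotv u v = (u *m v^T) 0 0.
Proof. by rewrite mxE; apply: eq_bigr => i _; rewrite mxE. Qed.

Lemma dotvC u v : dotv u v = dotv v u.
Proof. by apply: eq_bigr => i _; rewrite mulrC. Qed.

Lemma dotvDr u v w : dotv u (v + w) = dotv u v + dotv u w.
Proof. by rewrite -big_split; apply: eq_bigr => i _; rewrite mxE mulrDr. Qed.

Lemma dotvZr u (c : R) v : dotv u (c *: v) = c * dotv u v.
Proof. by rewrite mulr_sumr; apply: eq_bigr => i _; rewrite mxE mulrCA. Qed.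

Lemma dotvNr u v : dotv u (- v) = - dotv u v.
Proof. by rewrite -scaleN1r dotvZr mulN1r. Qed.

Lemma dotvBr u v w : dotv u (v - w) = dotv u v - dotv u w.
Proof. by rewrite dotvDr dotvNr. Qed.

Lemma dotvDl u v w : dotv (u + v) w = dotv u w + dotv v w.
Proof. by rewrite !(dotvC _ w) dotvDr. Qed.

Lemma dotvZl (c : R) u v : dotv (c *: u) v = c * dotv u v.
Proof. by rewrite !(dotvC _ v) dotvZr. Qed.

Lemma dotvBl u v w : dotv (u - v) w = dotv u w - dotv v w.
Proof. by rewrite !(dotvC _ w) dotvBr. Qed.

Lemma dotvv_gt0 v : v != 0 -> 0 < dotv v v.
Proof.
move=> v0; rewrite lt_neqAle eq_sym sumr_ge0 ?andbT => [|i _]; last first.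
  by rewrite -expr2 sqr_ge0.
apply: contraNneq v0 => /eqP; rewrite psumr_eq0 => [/allP v0|i _]; last first.
  by rewrite -expr2 sqr_ge0.
apply/eqP/rowP => i; rewrite mxE; apply/eqP; rewrite -sqrf_eq0 expr2.
by have := v0 i; rewrite mem_index_enum => /(_ isT).
Qed.

Lemma dotvv_ge0 v : 0 <= dotv v v.
Proof. by apply: sumr_ge0 => i _; rewrite -expr2 sqr_ge0. Qed.

Lemma norm2_ge0 v : 0 <= norm2 v.
Proof. exact: sqrtr_ge0. Qed.

Lemma sqr_norm2 v : norm2 v ^+ 2 = dotv v v.
Proof.
rewrite sqr_sqrtr; first by apply: eq_bigr => i _; rewrite expr2.
by apply: sumr_ge0 => i _; rewrite sqr_ge0.
Qed.

Lemma dotv_cauchy_schwarz u v : dotv u v ^+ 2 <= dotv u u * dotv v v.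
Proof.
have p1 : posdefmx (1%:M : 'M[R]_n).
  split=> [|w w0]; first by rewrite trmx1.
  by rewrite /qform mulmx1 -dotvE dotvv_gt0.
have := posdef_cauchy_schwarz u v p1.
by rewrite /qform invmx1 !mulmx1 -!dotvE.
Qed.

Lemma normr_dotv_le u v : `|dotv u v| <= norm2 u * norm2 v.
Proof.
rewrite -(@ler_pXn2r _ 2) ?nnegrE ?mulr_ge0 ?norm2_ge0 //.
by rewrite real_normK ?num_real // exprMn !sqr_norm2 dotv_cauchy_schwarz.
Qed.

End InnerProduct.

(** * Gram matrices and the log-determinant potential *)

Section EllipticPotential.
Variables (R : realType) (n : nat).
Implicit Types (g : nat -> 'rV[R]_n) (beta eta : R).

(** The weight [eta] is independent of [t]: the potential telescopes for a fixed weight, while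
    stability uses the weight of the round. *)
Definition gram beta eta g t : 'M[R]_n :=
  eta%:M + beta *: \sum_(1 <= s < t.+1) ((g s)^T *m g s).

Lemma qform_gram beta eta g t (w : 'rV[R]_n) :
  qform (gram beta eta g t) w =
    eta * dotv w w + beta * \sum_(1 <= s < t.+1) dotv (g s) w ^+ 2.
Proof.
rewrite /qform /gram mulmxDr mulmxDl mul_mx_scalar -scalemxAr -!scalemxAl.
rewrite mxE [X in X + _]mxE [X in _ + X]mxE -dotvE; congr (_ + _ * _).
rewrite mulmx_sumr mulmx_suml summxE; apply: eq_bigr => s _.
by rewrite mulmxA -(mulmxA (w *m _)) mxE big_ord1 -!dotvE (dotvC w) -expr2.
Qed.

Lemma posdef_gram beta eta g t :
  0 <= beta -> 0 < eta -> posdefmx (gram beta eta g t).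
Proof.
move=> beta0 eta0; split=> [|w w0].
  rewrite /gram linearD linearZ /= tr_scalar_mx linear_sum /=.
  by congr (_ + _ *: _); apply: eq_bigr => s _; rewrite trmx_mul trmxK.
rewrite qform_gram ltr_wpDr ?mulr_gt0 ?dotvv_gt0 //.
by rewrite mulr_ge0 // sumr_ge0 // => s _; rewrite sqr_ge0.
Qed.

Lemma gramS beta eta g t :
  gram beta eta g t = gram beta eta g t.+1 - beta *: ((g t.+1)^T *m g t.+1).
Proof. by rewrite /gram [in RHS]big_nat_recr //= scalerDr addrA addrK. Qed.

(** Enlarging the weight or adding rounds enlarges the primal form, hence shrinks the dual one. *)
Lemma qform_inv_gram_mono beta eta eta' g (v : 'rV[R]_n) (s t : nat) :
  0 <= beta -> 0 < eta -> eta <= eta' -> (s <= t)%N ->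
  qform (invmx (gram beta eta' g t)) v <= qform (invmx (gram beta eta g s)) v.
Proof.
move=> beta0 eta0 le_eta le_st; have eta'0 := lt_le_trans eta0 le_eta.
have pA := posdef_gram g s beta0 eta0.
have pB := posdef_gram g t beta0 eta'0.
have q0 := qform_inv_ge0 v pA.
apply: (qform_inv_le pB q0) => w; apply: le_trans (posdef_cauchy_schwarz v w pA) _.
apply: ler_wpM2l => //; rewrite !qform_gram lerD ?ler_wpM2r ?dotvv_ge0 //.
apply: ler_wpM2l => //; rewrite (@big_cat_nat _ _ _ s.+1 1 t.+1) //=.
by rewrite lerDl sumr_ge0 // => i _; rewrite sqr_ge0.
Qed.

Lemma qform_inv_gram_le beta eta g t (v : 'rV[R]_n) :
  0 <= beta -> 0 < eta ->
  qform (invmx (gram beta eta g t)) v <= dotv v v / eta.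
Proof.
move=> beta0 eta0; have pA := posdef_gram g t beta0 eta0.
apply: (qform_inv_le pA) => [|w]; first by rewrite divr_ge0 ?dotvv_ge0 // ltW.
rewrite -dotvE; apply: le_trans (dotv_cauchy_schwarz v w) _.
rewrite -mulrA ler_wpM2l ?dotvv_ge0 // qform_gram mulrDr mulKf ?gt_eqF // lerDl.
by rewrite !mulr_ge0 ?invr_ge0 ?(ltW eta0) // sumr_ge0 // => i _; rewrite sqr_ge0.
Qed.

(** By the rank-one determinant formula each summand times [beta] is [1 - D0 / D1], with [D0] and
    [D1] consecutive determinants; this is at most [ln D1 - ln D0], and the sum telescopes. *)
Lemma sum_qform_inv_gram_le_lndet beta eta g T : 0 < beta -> 0 < eta ->
  beta * \sum_(1 <= t < T.+1) qform (invmx (gram beta eta g t)) (g t)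
    <= ln (\det (gram beta eta g T)) - ln (\det (gram beta eta g 0)).
Proof.
move=> beta0 eta0; elim: T => [|T IHT]; first by rewrite big_geq // mulr0 subrr.
rewrite big_nat_recr //= mulrDr; apply: le_trans (lerD IHT (lexx _)) _.
rewrite addrAC lerB // -lerBrDl.
have pA t := posdef_gram g t (ltW beta0) eta0.
have /andP[d0 _] := posdef_det (pA T); have /andP[d1 _] := posdef_det (pA T.+1).
have := det_sub_rank1 beta (g T.+1) (posdef_unitmx (pA T.+1)).
rewrite -gramS; set q := beta * _; set D0 := \det _; set D1 := \det _ => E.
have r0 : 0 < D0 / D1 by rewrite divr_gt0.
have -> : q = 1 - D0 / D1 by rewrite E mulfK ?gt_eqF //; ring.
have /(@le_ln1Dx R) : - 1 < D0 / D1 - 1 by lra.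
rewrite addrCA subrr addr0 ln_div ?posrE //; lra.
Qed.

Lemma elliptic_potential beta eta (G : R) g T : (0 < n)%N ->
  0 < beta -> 0 < eta -> (forall t, (1 <= t <= T)%N -> norm2 (g t) <= G) ->
  \sum_(1 <= t < T.+1) qform (invmx (gram beta eta g t)) (g t)
    <= n%:R / beta * ln (1 + beta * G ^+ 2 * T%:R / (eta * n%:R)).
Proof.
move=> n0 beta0 eta0 gG.
have n0' : 0 < n%:R :> R by rewrite ltr0n.
have := sum_qform_inv_gram_le_lndet g T beta0 eta0.
rewrite -ler_pdivlMl // => /le_trans; apply; rewrite mulrAC mulrC ler_pM2r ?invr_gt0 //.
have pA t := posdef_gram g t (ltW beta0) eta0.
have /andP[d0 _] := posdef_det (pA 0%N); have /andP[d1 _] := posdef_det (pA T).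
have eD0 : \det (gram beta eta g 0) = eta ^+ n.
  by rewrite /gram big_geq // scaler0 addr0 det_scalar.
have trE : \tr (gram beta eta g T) =
    eta * n%:R + beta * \sum_(1 <= s < T.+1) dotv (g s) (g s).
  rewrite /gram mxtraceD mxtraceZ mxtrace_scalar mulr_natr raddf_sum.
  by congr (_ + _ * _); apply: eq_bigr => s _; rewrite /= mxtrace_mulC trace_mx11 dotvE.
have tr_le : \tr (gram beta eta g T) / n%:R / eta
    <= 1 + beta * G ^+ 2 * T%:R / (eta * n%:R).
  rewrite -mulrA -invfM ler_pdivrMr ?mulr_gt0 // trE mulrDl mul1r (mulrC n%:R) divfK.
    rewrite lerD2l -mulrA ler_pM2l // mulr_natr.
    have -> : G ^+ 2 *+ T = \sum_(1 <= s < T.+1) G ^+ 2.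
      by rewrite sumr_const_nat subn1.
    rewrite big_nat [leRHS]big_nat ler_sum // => s sT.
    by rewrite -sqr_norm2 ler_pXn2r ?nnegrE ?norm2_ge0 ?gG //
      (le_trans (norm2_ge0 _) (gG _ sT)).
  by rewrite mulf_neq0 ?gt_eqF.
have tr0 : 0 <= \tr (gram beta eta g T).
  rewrite trE addr_ge0 ?mulr_ge0 ?(ltW beta0) ?(ltW eta0) ?ler0n // sumr_ge0 //.
  by move=> s _; exact: dotvv_ge0.
rewrite -ln_div ?posrE // eD0.
have base_gt0 : 0 < 1 + beta * G ^+ 2 * T%:R / (eta * n%:R).
  rewrite ltr_pwDl // divr_ge0 // mulr_ge0 ?ler0n ?(ltW eta0) //.
  by rewrite mulr_ge0 ?sqr_ge0 ?(ltW beta0).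
rewrite mulr_natl -lnXn // ler_ln ?posrE ?exprn_gt0 ?divr_gt0 ?exprn_gt0 //.
rewrite ler_pdivrMr ?exprn_gt0 // -exprMn.
apply: le_trans (posdef_trace_det (pA T)) _.
rewrite ler_pXn2r ?nnegrE ?divr_ge0 ?mulr_ge0 ?(ltW base_gt0) ?(ltW eta0) ?ler0n //.
by rewrite -ler_pdivrMr.
Qed.

End EllipticPotential.

(** * Quadratic lower bound for exp-concave losses *)

Section ExpConcave.
Variables (R : realType) (n : nat).
Implicit Types (X : set 'rV[R]_n) (f : 'rV[R]_n -> R).

Lemma dotv_grad f (x v : 'rV[R]_n) : dotv (grad f x) v = 'd f x v.
Proof.
rewrite [in RHS](row_sum_delta v) linear_sum /=; apply: eq_bigr => i _.
by rewrite linearZ /= mxE mulrC.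
Qed.

Lemma expR_mul_onem_le1 (x : R) : expR x * (1 - x) <= 1.
Proof.
rewrite -[leRHS](expRxMexpNx_1 x) ler_pM2l ?expR_gt0 //.
by rewrite expR_ge1Dx.
Qed.

(** The tangent inequality at [x] for the concave function [exp (- alpha f)], divided by its value
    at [x]. It is obtained from difference quotients along the segment to [y]. *)
Lemma exp_concave_first_order alpha X f (x y : 'rV[R]_n) :
  exp_concave_on alpha X f -> differentiable f x -> X x -> X y ->
  expR (- alpha * (f y - f x)) <= 1 - alpha * dotv (grad f x) (y - x).
Proof.
move=> fX df Xx Xy; set v := y - x; set r := expR _.
rewrite dotv_grad -(deriveE _ df).
have dfv : derivable f x v := diff_derivable df.
pose q h := h^-1 *: ((f \o shift x) (h *: v) - f x).
have qD : q h @[h --> 0^'+] --> 'D_v f x by apply: cvg_dnbhs_at_right.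
pose a := r - 1.
(* With [b = alpha * q h], this expression is [((1 + h * a) * (1 + h * b) - 1) / h]; concavity makes
   it nonpositive for [h] in (0, 1), and the limit inherits the sign. *)
have psi_cvg : (a + alpha * q h) + h * (a * (alpha * q h)) @[h --> 0^'+]
     --> (a + alpha * 'D_v f x) + 0 * (a * (alpha * 'D_v f x)).
  have h0 : h @[h --> (0 : R)^'+] --> (0 : R) by exact: cvg_within.
  have aq : alpha * q h @[h --> 0^'+] --> alpha * 'D_v f x.
    by apply: cvgM => //; exact: cvg_cst.
  apply: cvgD; first by apply: cvgD => //; exact: cvg_cst.
  by apply: cvgM => //; apply: cvgM => //; exact: cvg_cst.
suff : (a + alpha * 'D_v f x) + 0 * (a * (alpha * 'D_v f x)) <= 0.
  by rewrite mul0r addr0 /a; lra.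
rewrite -(cvg_lim (@Rhausdorff R) psi_cvg).
apply: limr_le; first by apply/cvg_ex; eexists; exact: psi_cvg.
near=> h.
have h0 : 0 < h by near: h; exact: nbhs_right_gt.
have h1 : h < 1 by near: h; exact: nbhs_right_lt.
set b := alpha * q h.
have fh : f (h *: y + (1 - h) *: x) - f x = h * q h.
  rewrite /q /= mulrA mulfV ?gt_eqF // mul1r; congr (f _ - _).
  by rewrite /v scalerBl scale1r scalerBr addrCA addrC.
have r_ge : 1 + h * a <= expR (- (h * b)).
  have /= := fX y x Xy Xx h; rewrite (ltW h0) (ltW h1) => /(_ isT).
  rewrite -(ler_pM2r (expR_gt0 (alpha * f x))) mulrDl -!mulrA -!expRD.
  have shiftE z : - alpha * z + alpha * f x = - alpha * (z - f x) by ring.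
  rewrite !shiftE subrr mulr0 expR0 fh.
  have -> : - alpha * (h * q h) = - (h * b) by rewrite /b; ring.
  by rewrite /a -/r; lra.
have a_gtN1 : - 1 < a by rewrite /a; have := expR_gt0 (- alpha * (f y - f x)); rewrite -/r; lra.
have ha_gt0 : 0 < 1 + h * a by nra.
have : (1 + h * a) * (1 + h * b) <= 1.
  have [hb|hb] := leP 0 (1 + h * b); last by nra.
  apply: le_trans (expR_mul_onem_le1 (- (h * b))); rewrite opprK.
  exact: ler_wpM2r.
have -> : (1 + h * a) * (1 + h * b) = 1 + h * (a + b + h * (a * b)) by ring.
by rewrite gerDl pmulr_rle0.
Unshelve. all: by end_near. Qed.

Lemma expR_convex01 (p a : R) : 0 <= p <= 1 -> expR (p * a) <= p * expR a + (1 - p).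
Proof.
move=> /andP[p0 p1]; have := convex_expR (Itv01 p0 p1) a 0.
by rewrite !convRE expR0 mulr0 addr0 mulr1.
Qed.

(** Applied at [s = 2 * beta * <g, y - x>]; the square in the exponent becomes the quadratic term of
    the surrogate. *)
Lemma onem_le_expR_quadratic (s : R) : `|s| <= 4^-1 ->
  1 - s <= expR (- (s + s ^+ 2 / 4)).
Proof.
rewrite ler_norml => /andP[s1 s2].
(* [1 + x <= expR x] is too weak at [x = - (s + s ^+ 2 / 4)] itself, but its
   fourth power at [x / 4 = - v] suffices. *)
set v := s * (1 + s / 4) / 4.
have -> : - (s + s ^+ 2 / 4) = 4%:R * - v by rewrite /v; field.
have v_le : v <= 12^-1 by rewrite /v; nra.
(* The constant is [(15 / 16) ^+ 2 / 16], since [1 + s / 4 >= 15 / 16]. Multiplied by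
   [6 - 4 * v >= 17 / 3] it exceeds 1/4, which absorbs [- s ^+ 2 / 4] below. *)
have v2_ge : s ^+ 2 * (225 / 4096) <= v ^+ 2.
  have -> : v ^+ 2 = s ^+ 2 * ((1 + s / 4) ^+ 2 / 16) by rewrite /v; field.
  by apply: ler_wpM2l; [exact: sqr_ge0|nra].
rewrite expRM_natl; apply: (@le_trans _ _ ((1 - v) ^+ 4)); last first.
  by rewrite lerXn2r ?nnegrE ?expR_ge0 ?expR_ge1Dx //; lra.
have -> : (1 - v) ^+ 4 = 1 - 4 * v + v ^+ 2 * (6 - 4 * v) + (v ^+ 2) ^+ 2 by ring.
have -> : 1 - 4 * v = 1 - s - s ^+ 2 / 4 by rewrite /v; field.
have := sqr_ge0 (v ^+ 2); have := sqr_ge0 s; nra.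
Qed.

Lemma exp_concave_quadratic alpha beta X f (x y : 'rV[R]_n) :
  exp_concave_on alpha X f -> differentiable f x -> X x -> X y ->
  0 < beta -> 2 * beta <= alpha ->
  `|2 * beta * dotv (grad f x) (y - x)| <= 4^-1 ->
  f x - f y <= dotv (grad f x) (x - y)
               - beta / 2 * dotv (grad f x) (y - x) ^+ 2.
Proof.
move=> fX df Xx Xy beta0 le_beta small.
have := exp_concave_first_order fX df Xx Xy.
rewrite -(opprB y x) dotvNr; move: small; set z := dotv _ _ => small first_order.
(* Convexity of [expR] between 0 and the exponent lowers the parameter from [alpha] to [2 * beta] in
   the first-order inequality. *)
set p := 2 * beta / alpha.
have alpha0 : 0 < alpha by lra.
have p01 : 0 <= p <= 1.
  by rewrite divr_ge0 ?ler_pdivrMr ?mul1r ?le_beta ?ltW // mulr_gt0.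
have := le_trans (expR_convex01 (- alpha * (f y - f x)) p01)
  (lerD (ler_wpM2l (proj1 (andP p01)) first_order) (lexx _)).
have -> : p * (- alpha * (f y - f x)) = - (2 * beta) * (f y - f x).
  by rewrite /p; field; rewrite gt_eqF.
have -> : p * (1 - alpha * z) + (1 - p) = 1 - 2 * beta * z.
  by rewrite /p; field; rewrite gt_eqF.
move=> /le_trans/(_ (onem_le_expR_quadratic small)); rewrite ler_expR.
have -> : - (2 * beta * z + (2 * beta * z) ^+ 2 / 4)
    = - (2 * beta) * (z + beta / 2 * z ^+ 2) by field.
by rewrite ler_nM2l ?oppr_lt0 ?mulr_gt0 //; lra.
Qed.

End ExpConcave.

(** * Regularised quadratic objectives and their minimisers *)

Lemma cvg_sumr (R : realType) (T I : Type) (F : set_system T) (FF : Filter F)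
    (r : seq I) (P : pred I) (f : I -> T -> R) (l : I -> R) :
  (forall i, P i -> f i y @[y --> F] --> l i) ->
  \sum_(i <- r | P i) f i y @[y --> F] --> \sum_(i <- r | P i) l i.
Proof. by move=> fl; apply: cvg_big => //; exact: add_continuous. Qed.

Section RegularizedLeader.
Variables (R : realType) (n : nat).
Implicit Types (X : set 'rV[R]_n) (g x : nat -> 'rV[R]_n) (F : 'rV[R]_n -> R).

Definition argmin_on X F (a : 'rV[R]_n) : Prop :=
  X a /\ forall y, X y -> F a <= F y.

Definition surrogate (beta : R) (g x y : 'rV[R]_n) : R :=
  dotv g y + beta / 2 * dotv g (y - x) ^+ 2.

(** The predicate [P] selects the gradients that have arrived; [xpredT] gives the undelayed
    objective over the same rounds. *)
Definition reg_objective (beta eta : R) g x (r : seq nat) (P : pred nat)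
    (y : 'rV[R]_n) : R :=
  \sum_(s <- r | P s) surrogate beta (g s) (x s) y + eta / 2 * norm2 y ^+ 2.

Lemma dotv_continuous (g : 'rV[R]_n) : continuous (dotv g).
Proof.
move=> y; apply: (cvg_sumr (nbhs_filter y)) => i _.
apply: (cvgM (FF := nbhs_filter y)); first exact: cvg_cst.
exact: coord_continuous.
Qed.

Lemma sqr_norm2_continuous : continuous (fun y : 'rV[R]_n => norm2 y ^+ 2).
Proof.
rewrite (_ : (fun _ => _) = (fun y : 'rV[R]_n => dotv y y)); last first.
  by apply/funext => y; rewrite sqr_norm2.
move=> y; apply: (cvg_sumr (nbhs_filter y)) => i _.
by apply: (cvgM (FF := nbhs_filter y)); exact: coord_continuous.
Qed.

Lemma reg_objective_continuous beta eta g x r P :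
  continuous (reg_objective beta eta g x r P).
Proof.
move=> y; have FF := nbhs_filter y.
apply: (cvgD (FF := FF)); last first.
  by apply: (cvgM (FF := FF)); [exact: cvg_cst|exact: sqr_norm2_continuous].
apply: (cvg_sumr FF) => s _.
apply: (cvgD (FF := FF)); first exact: dotv_continuous.
apply: (cvgM (FF := FF)); first exact: cvg_cst.
have dx : (fun y => dotv (g s) (y - x s)) @ y --> dotv (g s) (y - x s).
  rewrite (_ : (fun _ => _) = (fun y => dotv (g s) y - dotv (g s) (x s))).
    rewrite dotvBr; apply: (cvgB (FF := FF)); last exact: cvg_cst.
    exact: dotv_continuous.
  by apply/funext => z; rewrite dotvBr.
exact: (cvgM (FF := FF) dx dx).
Qed.

Lemma normr_le_norm2 (y : 'rV[R]_n) : `|y| <= norm2 y.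
Proof.
rewrite [leLHS]/Num.Def.normr /= mx_normrE; apply/bigmax_leP; split; first exact: norm2_ge0.
move=> [i j] _ /=; rewrite (ord1 i).
rewrite -(@ler_pXn2r _ 2) ?nnegrE ?norm2_ge0 // real_normK ?num_real // sqr_norm2.
rewrite /dotv (bigD1 j) //= -expr2 lerDl sumr_ge0 // => k _.
by rewrite -expr2 sqr_ge0.
Qed.

(** Compactness of the domain; this supplies the comparison points [z_t]. *)
Lemma argmin_exists X (D : R) F : X 0 -> closed X ->
  (forall y, X y -> norm2 y <= D) -> continuous F -> exists a, argmin_on X F a.
Proof.
move=> X0 cX XD cF.
have kX : compact X.
  apply: bounded_closed_compact => //; exists D; split; first exact: num_real.
  move=> M DM y Xy; apply: le_trans (normr_le_norm2 y) _.
  by apply: le_trans (XD y Xy) _; exact: ltW.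
have [||c Xc cmin] := @EVT_min_rV R n F X _ kX; first by exists 0.
  exact: continuous_subspaceT.
by exists c; split=> [|y Xy]; [rewrite inE in Xc|apply: cmin; rewrite inE].
Qed.

Lemma convex_set_segment X (y z : 'rV[R]_n) (s : R) :
  convex_set X -> X y -> X z -> 0 <= s <= 1 -> X (z + s *: (y - z)).
Proof.
move=> cX Xy Xz /andP[s0 s1].
have := cX y z (Itv01 s0 s1); rewrite !inE => /(_ Xy Xz).
rewrite /conv /=; congr (X _).
by rewrite scalerBl scale1r scalerBr addrCA.
Qed.

Lemma ge0_of_ge0_quadratic (a b : R) :
  (forall s, 0 < s <= 1 -> 0 <= s * a + s ^+ 2 * b) -> 0 <= a.
Proof.
move=> H; rewrite leNgt; apply/negP => a0.
have c0 : 0 < `|b| - a by rewrite subr_gt0 (lt_le_trans a0).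
have bb := ler_norm b.
(* If [a < 0], this [s] lies in (0, 1/2] and satisfies [s * b <= - a / 2], so [a + s * b] is still
   negative. *)
pose s := - a / (`|b| - a) / 2.
have sE : s * (`|b| - a) * 2 = - a by rewrite /s; field; rewrite gt_eqF.
have s0 : 0 < s by rewrite /s !divr_gt0 ?oppr_gt0.
have s1 : s <= 1 by have := normr_ge0 b; nra.
have := H s; rewrite s0 s1 => /(_ isT).
have -> : s * a + s ^+ 2 * b = s * (a + s * b) by ring.
rewrite pmulr_rge0 //; nra.
Qed.

(** The objective is quadratic, so its second-order expansion is exact and the first-order condition
    follows by algebra. *)
Lemma reg_objective_expand beta eta g x r P (z v : 'rV[R]_n) (s : R) :
  reg_objective beta eta g x r P (z + s *: v) =
  reg_objective beta eta g x r P z +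
  s * (\sum_(t <- r | P t) (1 + beta * dotv (g t) (z - x t)) * dotv (g t) v
       + eta * dotv z v) +
  s ^+ 2 * (\sum_(t <- r | P t) beta / 2 * dotv (g t) v ^+ 2
            + eta / 2 * dotv v v).
Proof.
have -> : reg_objective beta eta g x r P (z + s *: v) =
    \sum_(t <- r | P t) (surrogate beta (g t) (x t) z
      + s * ((1 + beta * dotv (g t) (z - x t)) * dotv (g t) v)
      + s ^+ 2 * (beta / 2 * dotv (g t) v ^+ 2))
    + eta / 2 * norm2 (z + s *: v) ^+ 2.
  congr (_ + _); apply: eq_bigr => t _; rewrite /surrogate addrAC !dotvDr dotvZr.
  by field.
rewrite /reg_objective !big_split /= -!mulr_sumr !sqr_norm2.
by rewrite !(dotvDr, dotvDl, dotvZr, dotvZl) (dotvC v z); field.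
Qed.

Lemma argmin_first_order beta eta X g x r P (z y : 'rV[R]_n) :
  convex_set X -> argmin_on X (reg_objective beta eta g x r P) z -> X y ->
  0 <= \sum_(t <- r | P t)
         (1 + beta * dotv (g t) (z - x t)) * dotv (g t) (y - z)
       + eta * dotv z (y - z).
Proof.
move=> cX [Xz zmin] Xy.
apply: (@ge0_of_ge0_quadratic _
  (\sum_(t <- r | P t) beta / 2 * dotv (g t) (y - z) ^+ 2
   + eta / 2 * dotv (y - z) (y - z))) => s /andP[s0 s1].
have := zmin (z + s *: (y - z)).
rewrite reg_objective_expand -addrA lerDl; apply.
by apply: convex_set_segment => //; rewrite ltW.
Qed.

(** The first-order conditions of [a], tested at [z], and of [z], tested at [a], are added. Linear
    terms of arrived rounds cancel and those of missing rounds remain. *)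
Lemma argmin_stability beta eta X g x r P (a z : 'rV[R]_n) :
  convex_set X -> argmin_on X (reg_objective beta eta g x r P) a ->
  argmin_on X (reg_objective beta eta g x r xpredT) z ->
  eta * dotv (a - z) (a - z) + beta * \sum_(t <- r) dotv (g t) (a - z) ^+ 2
  <= \sum_(t <- r | ~~ P t)
       (1 + beta * dotv (g t) (a - x t)) * dotv (g t) (a - z).
Proof.
move=> cX amin zmin.
have fa := argmin_first_order cX amin (proj1 zmin).
have fz := argmin_first_order cX zmin (proj1 amin).
rewrite -(opprB a z) in fa; set w := a - z in fa fz *.
have wE : eta * dotv w w = eta * dotv a w - eta * dotv z w.
  by rewrite {1}/w dotvBl mulrBr.
(* Moving the coefficients from [z] to [a] releases one square per round, missing rounds included;
   hence the full Gram matrix on the left-hand side. *)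
have zE : \sum_(t <- r) (1 + beta * dotv (g t) (z - x t)) * dotv (g t) w =
    \sum_(t <- r) (1 + beta * dotv (g t) (a - x t)) * dotv (g t) w
    - beta * \sum_(t <- r) dotv (g t) w ^+ 2.
  rewrite mulr_sumr -sumrB; apply: eq_bigr => t _.
  by rewrite /w !dotvBr; ring.
have aE : \sum_(t <- r | P t) (1 + beta * dotv (g t) (a - x t)) * dotv (g t) (- w) =
    - \sum_(t <- r | P t) (1 + beta * dotv (g t) (a - x t)) * dotv (g t) w.
  by rewrite -sumrN; apply: eq_bigr => t _; rewrite dotvNr mulrN.
rewrite aE dotvNr in fa; rewrite zE [X in X - _](bigID P) /= in fz.
lra.
Qed.

(* Round [t] is regularised by [eta t.-1], hence only [eta T] appears after
   [T.+1] rounds. *)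
Lemma be_the_leader beta (eta : nat -> R) X g x (z : nat -> 'rV[R]_n) T u :
  0 <= eta 0 -> (forall t, (t < T)%N -> eta t <= eta t.+1) -> X u ->
  (forall t, (1 <= t <= T.+1)%N -> argmin_on X
     (reg_objective beta (eta t.-1) g x (index_iota 1 t.+1) xpredT) (z t)) ->
  \sum_(1 <= t < T.+2) surrogate beta (g t) (x t) (z t)
    <= \sum_(1 <= t < T.+2) surrogate beta (g t) (x t) u + eta T / 2 * norm2 u ^+ 2.
Proof.
move=> eta0; elim: T u => [|T IHT] u le_eta Xu zmin.
  have [_ /(_ u Xu)] := zmin 1%N isT; rewrite /reg_objective /=.
  rewrite !big_nat1; apply: le_trans; rewrite lerDl mulr_ge0 ?sqr_ge0 //.
  by rewrite divr_ge0.
have [Xz /(_ u Xu)] := zmin T.+2 (leqnn _); apply: le_trans.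
rewrite /reg_objective /= big_nat_recr //= [in leRHS]big_nat_recr //=.
rewrite addrAC lerD2r.
(* The comparator for the earlier rounds is the last leader; the last surrogate term is common to
   both sides. *)
apply: le_trans (IHT (z T.+2) _ Xz _) _.
- by move=> t tT; apply: le_eta; exact: ltnW.
- by move=> t /andP[t1 tT]; apply: zmin; rewrite t1 ltnW.
by rewrite lerD2l ler_wpM2r ?sqr_ge0 // ler_pM2r ?invr_gt0 // le_eta.
Qed.

End RegularizedLeader.

(** * Counting missing gradients *)

Section DelayCounting.
Variables (d : nat -> nat) (T : nat).

Lemma leq_dmax s : (1 <= s <= T)%N -> (d s <= dmax d T)%N.
Proof. by move=> sT; apply: leq_bigmax_seq; rewrite ?mem_index_iota. Qed.

Lemma count_iota_le (P : pred nat) (a b m n : nat) :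
  (forall i, P i -> (a <= i < b)%N -> (m <= i < n)%N) ->
  (\sum_(a <= i < b | P i) 1 <= n - m)%N.
Proof.
move=> Pmn; rewrite sum1_count -size_filter -[leqRHS](size_iota m).
apply: uniq_leq_size; first by rewrite filter_uniq ?iota_uniq.
by move=> i; rewrite mem_filter !mem_index_iota => /andP[/Pmn].
Qed.

(** A round missing at [t] lies in the window of the [dmax d T] rounds before [t]; the window is cut
    off at 0 by truncated subtraction. *)
Lemma card_m_le_dmax t : (t <= T.+1)%N -> (card_m d t <= dmax d T)%N.
Proof.
move=> tT; apply: leq_trans (_ : t - (t - dmax d T) <= _)%N; last by lia.
apply: count_iota_le => s; rewrite -leqNgt => st /andP[s1 s2].
by have := @leq_dmax s; lia.
Qed.

Variable R : realType.

Lemma sum_missing_current_le (p : nat -> R) : (forall t, 0 <= p t) ->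
  \sum_(1 <= t < T.+1) \sum_(1 <= s < t | ~~ (s + d s < t)%N) p t
    <= (dmax d T)%:R * \sum_(1 <= t < T.+1) p t.
Proof.
move=> p0; rewrite mulr_sumr big_nat [leRHS]big_nat; apply: ler_sum => t /andP[_ tT].
rewrite big_const_seq iter_addr_0 -sum1_count -(mulr_natl (p t)) ler_wpM2r ?p0 // ler_nat.
exact: card_m_le_dmax (ltnW tT).
Qed.

(** After exchanging the sums, round [s] is counted only for [s < t <= s + d s], that is at most
    [d s] times. *)
Lemma sum_missing_past_le (p : nat -> R) : (forall t, 0 <= p t) ->
  \sum_(1 <= t < T.+1) \sum_(1 <= s < t | ~~ (s + d s < t)%N) p s
    <= (dmax d T)%:R * \sum_(1 <= t < T.+1) p t.
Proof.
move=> p0; rewrite big_nat.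
under eq_bigr => t /andP[_ /ltnW tT] do rewrite (big_nat_widen _ _ _ _ _ tT).
rewrite (exchange_big_dep xpredT) //= mulr_sumr big_nat [leRHS]big_nat.
apply: ler_sum => s sT.
rewrite big_const_seq iter_addr_0 -sum1_count -(mulr_natl (p s)) ler_wpM2r ?p0 // ler_nat.
apply: leq_trans (leq_dmax sT).
rewrite -[leqRHS](_ : (s + d s).+1 - s.+1 = _)%N; last by lia.
by apply: count_iota_le => t; lia.
Qed.

End DelayCounting.

(** * From a bound on the local norm to a bound on the linear drift *)

Section LocalStability.
Variables (R : realType) (n : nat).

(* With [N := sqrt (qform A w)], Cauchy-Schwarz turns the hypothesis into
   [N <= c * sum_s sqrt (q_s)], which is fed back into [dotv v w <= sqrt q_v * N]. *)
Lemma dotv_le_of_qform_le (A : 'M[R]_n) (g : nat -> 'rV[R]_n) (c : nat -> R)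
    (C : R) (r : seq nat) (P : pred nat) (v w : 'rV[R]_n) :
  posdefmx A -> (forall s, s \in r -> P s -> `|c s| <= C) -> 0 <= C ->
  qform A w <= \sum_(s <- r | P s) c s * dotv (g s) w ->
  dotv v w <= C * \sum_(s <- r | P s)
                    (qform (invmx A) v + qform (invmx A) (g s)) / 2.
Proof.
move=> pA cC C0 Wle.
have q0 u := qform_inv_ge0 u pA.
pose q u := Num.sqrt (qform (invmx A) u); pose N := Num.sqrt (qform A w).
have W0 : 0 <= qform A w := posdef_qform_ge0 w pA.
have q_ge0 u : 0 <= q u by exact: sqrtr_ge0.
have N0 : 0 <= N by exact: sqrtr_ge0.
have CS u : `|dotv u w| <= q u * N.
  rewrite -(@ler_pXn2r _ 2) ?nnegrE ?mulr_ge0 // real_normK ?num_real //.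
  by rewrite exprMn !sqr_sqrtr // dotvE posdef_cauchy_schwarz.
have NN : N * N <= C * (\sum_(s <- r | P s) q (g s)) * N.
  rewrite -expr2 sqr_sqrtr //; apply: le_trans Wle _.
  rewrite mulr_sumr mulr_suml big_seq_cond [leRHS]big_seq_cond.
  apply: ler_sum => s /andP[sr Ps]; apply: le_trans (ler_norm _) _.
  by rewrite normrM -mulrA; apply: ler_pM => //; exact: cC.
have S0 : 0 <= C * \sum_(s <- r | P s) q (g s) by rewrite mulr_ge0 // sumr_ge0.
have N_le : N <= C * \sum_(s <- r | P s) q (g s).
  have [->//|Nn0] := eqVneq N 0.
  by rewrite -(ler_pM2r (_ : 0 < N)) // lt_neqAle eq_sym Nn0.
apply: le_trans (ler_norm _) _; apply: le_trans (CS v) _.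
apply: le_trans (ler_wpM2l (q_ge0 v) N_le) _.
rewrite mulrCA ler_wpM2l // mulr_sumr; apply: ler_sum => s _.
(* AM-GM separates the product [q v * q (g s)]. *)
have := sqr_ge0 (q v - q (g s)); rewrite sqrrB !sqr_sqrtr //; lra.
Qed.

End LocalStability.

(** * Surrogate regret of the delayed learner *)

Section DelayedONS.
Variables (R : realType) (n T : nat) (X : set 'rV[R]_n) (D G beta : R).
Variables (g x : nat -> 'rV[R]_n) (d : nat -> nat) (eta : nat -> R).
Hypotheses (n_gt0 : (0 < n)%N) (T_gt0 : (0 < T)%N).
Hypotheses (X0 : X 0) (closedX : closed X) (convexX : convex_set X).
Hypothesis diamX : forall y z, X y -> X z -> norm2 (y - z) <= D.
Hypotheses (beta_gt0 : 0 < beta) (betaGD : beta * (G * D) <= 8^-1).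
Hypotheses (D_gt0 : 0 < D) (G_gt0 : 0 < G).
Hypothesis g_le : forall t, (1 <= t <= T)%N -> norm2 (g t) <= G.
Hypothesis eta0_gt0 : 0 < eta 0.
Hypothesis eta_le : forall t, (t < T)%N -> eta t <= eta t.+1.
Hypothesis Xx : forall t, (1 <= t <= T)%N -> X (x t).
Hypothesis x_argmin : forall t, (1 <= t < T)%N -> argmin_on X
  (reg_objective beta (eta t) g x (index_iota 1 t.+1)
     (fun s => (s + d s < t.+1)%N)) (x t.+1).

(** [q] carries the weight used to compute [x t]; [p] carries the fixed weight [eta 0], to which the
    potential bound applies. *)
Let q t s := qform (invmx (gram beta (eta t.-1) g t)) (g s).
Let p t := qform (invmx (gram beta (eta 0) g t)) (g t).
Let L := ln (1 + beta * G ^+ 2 * T%:R / (eta 0%N * n%:R)).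

Lemma eta_mono s t : (s <= t <= T)%N -> eta s <= eta t.
Proof.
elim: t => [|t IHt]; first by rewrite leqn0 => /andP[/eqP->].
rewrite leq_eqVlt => /andP[/predU1P[->//|st] tT].
by apply: le_trans (eta_le tT); apply: IHt; rewrite -ltnS st ltnW.
Qed.

Lemma eta_gt0 t : (t <= T)%N -> 0 < eta t.
Proof. by move=> tT; apply: lt_le_trans eta0_gt0 _; apply: eta_mono. Qed.

(** This keeps the coefficients [1 + beta * <g, y - x>] of the first-order conditions within 1/8 of
    1. *)
Lemma dotv_g_le t y z : (1 <= t <= T)%N -> X y -> X z ->
  beta * `|dotv (g t) (y - z)| <= 8^-1.
Proof.
move=> tT Xy Xz; apply: le_trans betaGD; rewrite ler_pM2l //.
apply: le_trans (normr_dotv_le _ _) _.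
by rewrite ler_pM ?norm2_ge0 ?g_le ?diamX.
Qed.

(* [x 1] is arbitrary rather than a minimiser, so no optimality condition is
   available in round 1; the diameter bound on [w] is used instead. *)
Lemma first_round_stability z1 : X z1 ->
  dotv (g 1%N) (x 1%N - z1) <= q 1 1 + eta 0 * D ^+ 2.
Proof.
move=> Xz; set w := _ - z1; have T1 : (1 <= 1 <= T)%N by [].
have pA := posdef_gram g 1 (ltW beta_gt0) eta0_gt0.
have := posdef_cauchy_schwarz (g 1%N) w pA; rewrite -dotvE -/(q 1 1).
rewrite qform_gram big_nat1; set s := dotv _ w => CS.
have small : beta * `|s| <= 8^-1 by apply: dotv_g_le => //; exact: Xx.
have ww : dotv w w <= D ^+ 2.
  by rewrite -sqr_norm2 lerXn2r ?nnegrE ?norm2_ge0 ?(ltW D_gt0) // diamX //; exact: Xx.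
have etaww : eta 0 * dotv w w <= eta 0 * D ^+ 2 by rewrite ler_pM2l.
have betas : beta * s ^+ 2 <= `|s| / 8.
  by rewrite -(real_normK (num_real s)) expr2 mulrCA ler_wpM2l.
have q0 : 0 <= q 1 1 := qform_inv_ge0 _ pA.
have CS' : `|s| ^+ 2 <= q 1 1 * (eta 0 * D ^+ 2 + `|s| / 8).
  by rewrite real_normK ?num_real //; apply: le_trans CS _; apply: ler_wpM2l => //; lra.
have e0 : 0 <= eta 0 * D ^+ 2 by rewrite mulr_ge0 ?sqr_ge0 // ltW.
apply: le_trans (ler_norm _) _; have := normr_ge0 s.
(* Now [b ^+ 2 <= a * (e + b / 8)], whereas [b > a + e] would force [b ^+ 2 > a * b + a * e]. *)
move: CS' e0 q0; move: (eta 0 * _) (q 1 1) `|s| => e a b; nra.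
Qed.

Lemma round_stability t z : (1 < t <= T)%N ->
  argmin_on X (reg_objective beta (eta t.-1) g x (index_iota 1 t.+1) xpredT) z ->
  dotv (g t) (x t - z) <= 2 * q t t +
    \sum_(1 <= s < t | ~~ (s + d s < t)%N) (q t t + q t s).
Proof.
case: t => // t; rewrite ltnS => tT zmin.
have Xxt : X (x t.+1) by apply: Xx; case/andP: tT.
have pA := posdef_gram g t.+1 (ltW beta_gt0) (eta_gt0 (ltnW (proj2 (andP tT)))).
(* The index range is extended by the current round, which the arrival predicate always rejects; the
   two objectives then share weight and range, and the missing rounds are those of [m_t] together
   with the current one. *)
have xmin : argmin_on X (reg_objective beta (eta t) g x (index_iota 1 t.+2)
     (fun s => (s + d s < t.+1)%N)) (x t.+1).
  have := x_argmin tT; congr (argmin_on X _ _); apply/funext => y.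
  rewrite /reg_objective; congr (_ + _).
  rewrite [LHS]big_mkcond [RHS]big_mkcond [in RHS]big_nat_recr //=.
  by rewrite ifN ?addr0 // -leqNgt leq_addr.
have := argmin_stability convexX xmin zmin.
rewrite -qform_gram => stab.
(* The constant 2 bounds coefficients that are at most 9/8, and cancels the halves coming from
   AM-GM. *)
have := @dotv_le_of_qform_le _ _ _ g _ 2 _ _ (g t.+1) _ pA _ _ stab.
have -> : \sum_(s <- index_iota 1 t.+2 | ~~ (s + d s < t.+1)%N)
     (q t.+1 t.+1 + q t.+1 s) / 2 =
   q t.+1 t.+1 + 2^-1 * \sum_(1 <= s < t.+1 | ~~ (s + d s < t.+1)%N)
     (q t.+1 t.+1 + q t.+1 s).
  rewrite big_mkcond big_nat_recr //= -big_mkcond /= ifT; last first.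
    by rewrite -leqNgt leq_addr.
  by rewrite -mulr_suml; field.
move=> H; apply: le_trans (H _ _) _; last by lra.
- move=> s; rewrite mem_index_iota => /andP[s1 s2] _.
  have sT : (1 <= s <= T)%N by move: s1 s2; case/andP: tT; lia.
  apply: le_trans (ler_normD _ _) _; rewrite normr1 normrM (gtr0_norm beta_gt0).
  by have := dotv_g_le sT Xxt (Xx sT); lra.
- by [].
Qed.

(** For the first bound, [q t s] is at most [p s] by monotonicity, and each [p] occurs at most
    [dmax d T] times as current and as past round. For the second, every [q t s] is at most
    [G ^+ 2 / eta t.-1]. *)
Lemma sum_missing_le_min :
  \sum_(1 <= t < T.+1) \sum_(1 <= s < t | ~~ (s + d s < t)%N) (q t t + q t s)
  <= 2 * Num.min ((dmax d T)%:R * (n%:R / beta * L))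
           (G ^+ 2 * \sum_(1 <= t < T.+1) (card_m d t)%:R / eta t.-1).
Proof.
have b0 := ltW beta_gt0.
have p0 t : 0 <= p t by apply/qform_inv_ge0/posdef_gram.
have qp t s : (1 <= s <= t)%N -> (t <= T)%N -> q t s <= p s.
  move=> /andP[s1 st] tT; apply: qform_inv_gram_mono => //.
  by apply: eta_mono; rewrite leq0n (leq_trans (leq_pred t)).
have p_sum : \sum_(1 <= t < T.+1) p t <= n%:R / beta * L.
  exact: elliptic_potential.
rewrite -ler_pdivrMl // le_min; apply/andP; split; rewrite ler_pdivrMl //.
  apply: (@le_trans _ _ (\sum_(1 <= t < T.+1)
      \sum_(1 <= s < t | ~~ (s + d s < t)%N) (p t + p s))).
    rewrite big_nat [leRHS]big_nat; apply: ler_sum => t /andP[t1 tT].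
    rewrite big_nat_cond [leRHS]big_nat_cond; apply: ler_sum => s /andP[/andP[s1 st] _].
    by apply: lerD; apply: qp; rewrite ?t1 ?s1 ?leqnn //= ltnW.
  under eq_bigr do rewrite big_split /=; rewrite big_split /=.
  have := sum_missing_current_le d T p0; have := sum_missing_past_le d T p0.
  have := ler_wpM2l (ler0n R (dmax d T)) p_sum; lra.
rewrite mulr_sumr mulr_sumr big_nat [leRHS]big_nat; apply: ler_sum => t /andP[t1 tT].
have et : 0 < eta t.-1 by apply: eta_gt0; rewrite (leq_trans (leq_pred t)).
have qG s : (1 <= s <= T)%N -> q t s <= G ^+ 2 / eta t.-1.
  move=> sT; apply: le_trans (qform_inv_gram_le _ _ _ b0 et) _.
  by rewrite ler_pM2r ?invr_gt0 // -sqr_norm2 lerXn2r ?nnegrE ?norm2_ge0 ?(ltW G_gt0) ?g_le.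
apply: (@le_trans _ _ (\sum_(1 <= s < t | ~~ (s + d s < t)%N) 2 * (G ^+ 2 / eta t.-1))).
  rewrite big_nat_cond [leRHS]big_nat_cond; apply: ler_sum => s /andP[/andP[s1 st] _].
  have q1 := qG t; have q2 := qG s; rewrite mulr2n mulrDl !mul1r.
  apply: lerD; [apply: q1|apply: q2]; lia.
rewrite big_const_seq iter_addr_0 -sum1_count -[X in _ *+ X]/(card_m d t) -mulr_natl.
by rewrite le_eqVlt; apply/orP; left; apply/eqP; ring.
Qed.

Lemma delayed_ons_surrogate_regret u : X u ->
  \sum_(1 <= t < T.+1)
     (surrogate beta (g t) (x t) (x t) - surrogate beta (g t) (x t) u)
  <= 2 * (n%:R / beta * L + eta T * D ^+ 2
          + Num.min ((dmax d T)%:R * (n%:R / beta * L))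
              (G ^+ 2 * \sum_(1 <= t < T.+1) (card_m d t)%:R / eta t.-1)).
Proof.
move=> Xu; have b0 := ltW beta_gt0.
have normX y : X y -> norm2 y <= D by move=> Xy; rewrite -(subr0 y) diamX.
have /choice[z zmin] : forall t, exists a, argmin_on X
    (reg_objective beta (eta t.-1) g x (index_iota 1 t.+1) xpredT) a.
  by move=> t; apply: (argmin_exists X0 closedX normX); exact: reg_objective_continuous.
have btl : \sum_(1 <= t < T.+1) surrogate beta (g t) (x t) (z t)
    <= \sum_(1 <= t < T.+1) surrogate beta (g t) (x t) u + eta T / 2 * D ^+ 2.
  (* [T.-1] stands for [T] rounds here; the final weight [eta T.-1] is then raised to [eta T]. *)
  have := @be_the_leader _ _ beta eta X g x z T.-1 u (ltW eta0_gt0) _ Xu (fun t _ => zmin t).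
  rewrite prednK //; move=> H; apply: le_trans (H _) _.
    by move=> t tT; apply: eta_le; lia.
  rewrite lerD2l; apply: ler_pM.
  - by rewrite divr_ge0 // ltW // eta_gt0 // leq_pred.
  - exact: sqr_ge0.
  - by rewrite ler_pM2r ?invr_gt0 //; apply: eta_mono; rewrite leq_pred leqnn.
  - by rewrite lerXn2r ?nnegrE ?norm2_ge0 ?(ltW D_gt0) ?normX.
(* The quadratic term vanishes at [x t] and is nonnegative at [z t], so only the linear difference
   is paid. *)
have lin t : surrogate beta (g t) (x t) (x t)
    <= surrogate beta (g t) (x t) (z t) + dotv (g t) (x t - z t).
  rewrite /surrogate !dotvBr subrr.
  have := mulr_ge0 (divr_ge0 b0 (ler0n R 2)) (sqr_ge0 (dotv (g t) (z t) - dotv (g t) (x t))).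
  by rewrite expr0n /=; lra.
have step t : (1 <= t < T.+1)%N -> dotv (g t) (x t - z t) <=
    (if t == 1%N then eta 0 * D ^+ 2 else 0) + 2 * q t t +
    \sum_(1 <= s < t | ~~ (s + d s < t)%N) (q t t + q t s).
  case: t => [//|[|t]] /andP[_ tT]; rewrite /= ?add0r.
    have := first_round_stability (proj1 (zmin 1%N)); rewrite big_geq //.
    have : 0 <= q 1 1 by apply/qform_inv_ge0/posdef_gram.
    lra.
  exact: round_stability.
have sum_step : \sum_(1 <= t < T.+1) dotv (g t) (x t - z t) <=
    eta 0 * D ^+ 2 + 2 * \sum_(1 <= t < T.+1) q t t +
    \sum_(1 <= t < T.+1) \sum_(1 <= s < t | ~~ (s + d s < t)%N) (q t t + q t s).
  have -> : eta 0 * D ^+ 2 =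
      \sum_(1 <= t < T.+1) if t == 1%N then eta 0 * D ^+ 2 else 0.
    rewrite big_ltn // big_nat big1 ?addr0 // => t /andP[t2 _].
    by rewrite gtn_eqF.
  rewrite mulr_sumr -!big_split /= big_nat [leRHS]big_nat.
  by apply: ler_sum => t tT; exact: step.
have qsum : \sum_(1 <= t < T.+1) q t t <= n%:R / beta * L.
  apply: le_trans (elliptic_potential n_gt0 beta_gt0 eta0_gt0 g_le).
  rewrite big_nat [leRHS]big_nat; apply: ler_sum => t /andP[t1 tT].
  apply: qform_inv_gram_mono => //.
  by apply: eta_mono; rewrite leq0n (leq_trans (leq_pred t)).
have etaD : eta 0 * D ^+ 2 <= eta T * D ^+ 2.
  by rewrite ler_wpM2r ?sqr_ge0 // eta_mono // leq0n leqnn.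
have missing := sum_missing_le_min.
have sum_lin : \sum_(1 <= t < T.+1) surrogate beta (g t) (x t) (x t) <=
    \sum_(1 <= t < T.+1) surrogate beta (g t) (x t) (z t)
    + \sum_(1 <= t < T.+1) dotv (g t) (x t - z t).
  by rewrite -big_split /=; apply: ler_sum => t _; exact: lin.
(* The leader contributes half of [eta T * D ^+ 2] and the first round at most one more; the factor
   2 covers both. *)
rewrite sumrB; have e0 : 0 <= eta T * D ^+ 2.
  by rewrite mulr_ge0 ?sqr_ge0 // ltW // eta_gt0.
lra.
Qed.

End DelayedONS.

(** [C] is chosen before all data, hence absolute; the supremum in the regret is expressed by a
    bound for every [u] in [X]. *)
Theorem theorem4p1 :
  exists C : nat, forall (R : realType) (n T : nat)
    (X : set 'rV[R]_n) (D alpha G : R)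
    (f : nat -> 'rV[R]_n -> R) (d : nat -> nat) (eta : nat -> R)
    (x : nat -> 'rV[R]_n),
  (1 <= n)%N -> (1 <= T)%N ->
  X 0 -> closed X -> convex_set X ->
  0 < D -> (forall y z, X y -> X z -> norm2 (y - z) <= D) ->
  0 < alpha -> 0 < G ->
  (forall t, (1 <= t <= T)%N ->
     [/\ forall y, X y -> differentiable (f t) y,
         convex_on X (f t),
         exp_concave_on alpha X (f t) &
         forall y, X y -> norm2 (grad (f t) y) <= G]) ->
  (forall t, (1 <= t <= T)%N -> (t + d t <= T)%N) ->
  0 < eta 0%N -> (forall t, (t < T)%N -> eta t <= eta t.+1) ->
  let beta := 2^-1 * Num.min (4 * G * D)^-1 alpha in
  X (x 1%N) ->
  (forall t, (1 <= t < T)%N ->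
     X (x t.+1) /\
     forall y, X y -> ons_objective f d x beta eta t (x t.+1)
                      <= ons_objective f d x beta eta t y) ->
  let L := ln (1 + beta * G ^+ 2 * T%:R / (eta 0%N * n%:R)) in
  let B1 := (G ^+ 2 / eta 0%N + beta^-1) * n%:R * (dmax d T)%:R * L in
  let B2 := G ^+ 2 * \sum_(1 <= t < T.+1) (card_m d t)%:R / eta t.-1 in
  forall u, X u ->
    \sum_(1 <= t < T.+1) (f t (x t) - f t u)
      <= C%:R * (n%:R / beta * L + eta T * D ^+ 2 + Num.min B1 B2).

Proof.
exists 2%N => R n T X D alpha G f d eta x n_gt0 T_gt0 X0 cX convX D_gt0 diamX.
move=> alpha_gt0 G_gt0 loss delay eta0_gt0 eta_le beta Xx1 ons L B1 B2 u Xu.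
have GD_gt0 : 0 < G * D by rewrite mulr_gt0.
have beta_gt0 : 0 < beta.
  by rewrite mulr_gt0 ?invr_gt0 // lt_min alpha_gt0 invr_gt0 -mulrA mulr_gt0.
have beta_alpha : 2 * beta <= alpha.
  by rewrite /beta mulrA divff // mul1r ge_min lexx orbT.
(* The first argument of the minimum defining [beta] gives exactly 1/8. *)
have betaGD : beta * (G * D) <= 8^-1.
  have -> : 8^-1 = 2^-1 * (4 * G * D)^-1 * (G * D) :> R.
    by field; rewrite !gt_eqF.
  by rewrite ler_pM2r // ler_pM2l // ge_min lexx.
have Xx t : (1 <= t <= T)%N -> X (x t).
  case: t => [//|[//|t]] /andP[_ tT]; by have [] := ons t.+1 tT.
pose g t := grad (f t) (x t).
have g_le t : (1 <= t <= T)%N -> norm2 (g t) <= G.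
  by move=> tT; have [_ _ _] := loss t tT; apply; exact: Xx.
have x_argmin t : (1 <= t < T)%N -> argmin_on X
    (reg_objective beta (eta t) g x (index_iota 1 t.+1)
       (fun s => (s + d s < t.+1)%N)) (x t.+1) by exact: ons.
(* Passing to surrogates costs no constant, so the factor 2 of the surrogate regret is the final
   one. *)
have linearize t : (1 <= t < T.+1)%N -> f t (x t) - f t u <=
    surrogate beta (g t) (x t) (x t) - surrogate beta (g t) (x t) u.
  move=> tT; have [df _ fexp _] := loss t tT; have Xxt := Xx t tT.
  have small : `|2 * beta * dotv (g t) (u - x t)| <= 4^-1.
    have := dotv_g_le diamX beta_gt0 betaGD g_le tT Xu Xxt.
    by rewrite normrM (gtr0_norm (mulr_gt0 (ltr0n R 2) beta_gt0)); lra.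
  apply: le_trans (exp_concave_quadratic fexp (df _ Xxt) Xxt Xu beta_gt0 beta_alpha small) _.
  by rewrite /surrogate -/(g t) !dotvBr subrr expr0n /=; lra.
apply: (@le_trans _ _ (\sum_(1 <= t < T.+1)
    (surrogate beta (g t) (x t) (x t) - surrogate beta (g t) (x t) u))).
  by rewrite big_nat [leRHS]big_nat; apply: ler_sum.
apply: le_trans (delayed_ons_surrogate_regret n_gt0 T_gt0 X0 cX convX diamX
  beta_gt0 betaGD D_gt0 G_gt0 g_le eta0_gt0 eta_le Xx x_argmin Xu) _.
rewrite ler_pM2l // lerD2l le_min ge_min [X in _ && X]ge_min lexx orbT andbT.
apply/orP; left; rewrite -/L.
have L_ge0 : 0 <= L.
  apply: ln_ge0; rewrite lerDl; apply: divr_ge0; apply: mulr_ge0 => //; last exact: ltW.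
  by apply: mulr_ge0; [exact: ltW|exact: sqr_ge0].
(* [B1] is the delay bound already obtained plus a nonnegative term. *)
have -> : B1 = (dmax d T)%:R * (n%:R / beta * L)
    + G ^+ 2 / eta 0 * (n%:R * (dmax d T)%:R * L) by rewrite /B1; ring.
by rewrite lerDl mulr_ge0 ?divr_ge0 ?sqr_ge0 ?(ltW eta0_gt0) // !mulr_ge0.
Qed.
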